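(* Let $Q\subset\mathbb{R}^n$ be closed and convex, let $f$ admit a $(\delta,\Delta,L,\mu)$-model $\psi(y,x)$ at every point $x\in Q$, and run the adaptive gradient method described in the context from $x^0\in Q$. Let $x_*$ denote the minimizer of $f$ on $Q$ nearest to $x^0$ in the sense of the Bregman divergence. Then for the iterates $x^1,\dots,x^{k+1}$ of the method, the accepted parameters $L_{i+1},\delta_{i+1},\Delta_{i+1}$ ($i=0,\dots,k$) and $y^{k+1}:=\arg\min_{i=0,\dots,k} f(x^{i+1})$ (that is, $y^{k+1}$ is a point of $\{x^1,\dots,x^{k+1}\}$ with the smallest value of $f$), one has $$f(y^{k+1})-f(x_* )\leqslant\frac{1}{\sum_{i=0}^k\frac{1}{L_{i+1}}\prod_{j=i+1}^k\left(1-\frac{\mu}{L_j}\right)}\left(\prod_{i=0}^k\left(1-\frac{\mu}{L_{i+1}}\right)V(x_*,x^0)+\sum_{i=0}^k\frac{\delta+\delta_{i+1}+\Delta_{i+1}\|x^{i+1}-x^i\|}{L_{i+1}}\prod_{j=i+1}^k\left(1-\frac{\mu}{L_j}\right)\right).$$ Moreover, over $k$ iterations the auxiliary problem $\min_{x\in Q}\{\psi(x,x^k)+L_{k+1}V(x,x^k)\}$ of the method is solved at most $$2k+\max\left\{\log_2\frac{2L}{L_0},\ \log_2\frac{2\delta}{\delta_0},\ \log_2\frac{2\Delta}{\Delta_0}\right\}$$ times.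
   Context: Conventions: $\|\cdot\|$ is a norm on $\mathbb{R}^n$; an empty product $\prod_{i=k+1}^{k}a_i$ equals $1$. Bregman divergence: $V(y,x)=d(y)-d(x)-\langle\nabla d(x),y-x\rangle$ for $x,y\in Q$, where $d$ is a convex function differentiable at all points of $Q$ (strong convexity of $d$ is not required). Inexact values: for a fixed $\delta\geqslant 0$, $f_\delta(x)\in[f(x)-\delta,f(x)]$ for all $x\in Q$. Model: $f$ admits a $(\delta,\Delta,L,\mu)$-model $\psi(y,x)$ if $\psi$ is convex in the first variable, $\psi(x,x)=0$ for all $x$, and for all $x,y\in Q$ $$f(y)\leqslant f_\delta(x)+\psi(y,x)+\Delta\|y-x\|+\delta+LV(y,x),$$ $$f(x)-\delta+\psi(x_*,x)+\mu V(x_*,x)\leqslant f_\delta(x)+\psi(x_*,x)+\mu V(x_*,x)\leqslant f(x_* ),$$ where in the second line $x_*$ is the minimizer of $f$ on $Q$ nearest to $x$ in the sense of the divergence $V(x_*,x)$. Method. Input: $x^0\in Q$ with $V(x_*,x^0)\leqslant R^2$, and parameters $L_0,\Delta_0,\delta_0>0$ with $2\mu<L_0\leqslant 2L$, $\Delta_0\leqslant 2\Delta$, $\delta_0\leqslant 2\delta$. For $k=0,1,2,\dots$: 1. Set $L_{k+1}:=\max\{\mu,L_k/2\}$, $\Delta_{k+1}:=\Delta_k/2$, $\delta_{k+1}:=\delta_k/2$. 2. Compute $x^{k+1}:=\arg\min_{x\in Q}\{\psi(x,x^k)+L_{k+1}V(x,x^k)\}$. 3. If $f_\delta(x^{k+1})\leqslant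 f_\delta(x^k)+\psi(x^{k+1},x^k)+L_{k+1}V(x^{k+1},x^k)+\delta_{k+1}+\Delta_{k+1}\|x^{k+1}-x^k\|$, accept $x^{k+1}$ and pass to the next iteration ($k:=k+1$, step 1); otherwise set $L_{k+1}:=2L_{k+1}$, $\delta_{k+1}:=2\delta_{k+1}$, $\Delta_{k+1}:=2\Delta_{k+1}$ and return to step 2.
   Formalization: In the normalizing sum and the error sum the inner product is taken over 1 − μ/L_{j+1} instead of the printed 1 − μ/L_j; with the printed index the bound is false already for k = 1. *)

(* Defs.v *)
From mathcomp Require Import all_boot all_order all_algebra.
From mathcomp Require Import all_classical all_reals all_analysis.

Set Implicit Arguments.
Unset Strict Implicit.
Unset Printing Implicit Defensive.

Import Order.TTheory GRing.Theory Num.Theory.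
Import numFieldNormedType.Exports.

Local Open Scope classical_set_scope.
Local Open Scope ring_scope.

Section Geometry.
Context {R : realType} {n : nat}.
Implicit Types (x y z : 'rV[R]_n) (Q : set 'rV[R]_n) (f g d : 'rV[R]_n -> R).

(* The norm of R^n is arbitrary, whereas the library norm `|x| on 'rV[R]_n is
   the sup norm. Both give the same closed sets and differentiable functions. *)
Record is_norm (N : 'rV[R]_n -> R) : Prop := IsNorm {
  norm_triangle : forall x y, N (x + y) <= N x + N y;
  norm_homogeneous : forall (a : R) x, N (a *: x) = `|a| * N x;
  norm_definite : forall x, N x = 0 -> x = 0 }.

Definition dotp x y : R := \sum_(i < n) x ord0 i * y ord0 i.

Definition grad d x : 'rV[R]_n := \row_(i < n) 'D_(delta_mx ord0 i) d x.

Definition bregman d y x : R := d y - d x - dotp (grad d x) (y - x).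

Definition is_argmin Q g z : Prop := Q z /\ forall y, Q y -> g z <= g y.

Definition nearest_minimizer Q f (V : 'rV[R]_n -> 'rV[R]_n -> R) xs x : Prop :=
  is_argmin [set z | is_argmin Q f z] (V^~ x) xs.

Definition inexact_value Q f fdelta (delta : R) : Prop :=
  forall x, Q x -> f x - delta <= fdelta x /\ fdelta x <= f x.

(* The lower bound presupposes that x has a nearest minimizer xs. *)
Record has_model Q f fdelta (psi V : 'rV[R]_n -> 'rV[R]_n -> R)
    (N : 'rV[R]_n -> R) (delta Delta L mu : R) : Prop := HasModel {
  model_convex : forall x, Q x -> convex_function Q (psi^~ x);
  model_diag : forall x, Q x -> psi x x = 0;
  model_upper : forall x y, Q x -> Q y ->
    f y <= fdelta x + psi y x + Delta * N (y - x) + delta + L * V y x;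
  model_lower : forall x, Q x -> exists2 xs, nearest_minimizer Q f V xs x &
    f x - delta + psi xs x + mu * V xs x
      <= fdelta x + psi xs x + mu * V xs x /\
    fdelta x + psi xs x + mu * V xs x <= f xs }.

End Geometry.

Section Method.
Context {R : realType}.

Record params := Params { pL : R; pdelta : R; pDelta : R }.

Definition start_params (mu : R) (p : params) : params :=
  Params (Num.max mu (pL p / 2)) (pdelta p / 2) (pDelta p / 2).

Definition double_params (p : params) : params :=
  Params (2 * pL p) (2 * pdelta p) (2 * pDelta p).

Context {n : nat}.

Definition acceptable (fdelta : 'rV[R]_n -> R)
    (psi V : 'rV[R]_n -> 'rV[R]_n -> R) (N : 'rV[R]_n -> R)
    (x : 'rV[R]_n) (p : params) (z : 'rV[R]_n) : Prop :=
  fdelta z <= fdelta x + psi z x + pL p * V z x + pdelta p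
              + pDelta p * N (z - x).

(* [execution ... xs ps p s]: some execution prefix of the method, stopped just
   before an auxiliary problem is solved, has
   - accepted the points xs = [:: x^0; ...; x^k],
   - accepted the parameters ps = [:: p_0; ...; p_k] (p_0 being the input),
   - p as current trial parameters of iteration k = (size xs).-1,
   - s as log of the auxiliary problems solved so far: one entry per problem,
     namely the index of the iteration during which it was solved.
   The iteration in progress need not terminate, and any minimizer of an
   auxiliary problem may be returned. *)
Inductive execution (Q : set 'rV[R]_n) (fdelta : 'rV[R]_n -> R)
    (psi V : 'rV[R]_n -> 'rV[R]_n -> R) (N : 'rV[R]_n -> R) (mu : R)
    (x0 : 'rV[R]_n) (p0 : params) :
    seq 'rV[R]_n -> seq params -> params -> seq nat -> Prop :=
| exec_init :
    execution Q fdelta psi V N mu x0 p0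
      [:: x0] [:: p0] (start_params mu p0) [::]
| exec_accept xs ps p s z :
    execution Q fdelta psi V N mu x0 p0 xs ps p s ->
    is_argmin Q (fun x => psi x (last x0 xs) + pL p * V x (last x0 xs)) z ->
    acceptable fdelta psi V N (last x0 xs) p z ->
    execution Q fdelta psi V N mu x0 p0
      (rcons xs z) (rcons ps p) (start_params mu p) (rcons s (size xs).-1)
| exec_reject xs ps p s z :
    execution Q fdelta psi V N mu x0 p0 xs ps p s ->
    is_argmin Q (fun x => psi x (last x0 xs) + pL p * V x (last x0 xs)) z ->
    ~ acceptable fdelta psi V N (last x0 xs) p z ->
    execution Q fdelta psi V N mu x0 p0
      xs ps (double_params p) (rcons s (size xs).-1).

End Method.

Arguments params : clear implicits.

Definition log2 {R : realType} (x : R) : R := ln x / ln 2.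

(* Main.v *)
Require Import Defs.
From mathcomp Require Import all_boot all_order all_algebra.
From mathcomp Require Import all_classical all_reals all_analysis.
From mathcomp Require Import ring lra.

Set Implicit Arguments.
Unset Strict Implicit.
Unset Printing Implicit Defensive.

Import Order.TTheory GRing.Theory Num.Theory.
Import numFieldNormedType.Exports.
Local Open Scope classical_set_scope.
Local Open Scope ring_scope.


(** Both claims are consequences of one iteration, analysed in two ways.

    Convergence. The point accepted from [x] minimizes
    [psi y x + l * V y x], a convex function plus [l] times the differentiable
    convex function [V^~ x]. First-order optimality and the three-point identity
    of the Bregman divergence give, for every [u] in [Q] and the minimizer [z],
      [psi z x + l * V z x + l * V u z <= psi u x + l * V u x]
    ([prox_three_point]). With the acceptance test at [z] and the lower model
    bound at [u] := the minimizer of [f] nearest to [x], this becomes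
      [V zs z <= (1 - mu / l) * V xs x + (error - (f z - f xs)) / l]
    ([accepted_step_descent]). The nearest minimizer may change from one iterate
    to the next, but replacing it by the one nearest to [z] only decreases the
    left-hand side, so the distances to the set of minimizers satisfy a linear
    recursion. Unrolling it ([linear_recursion_le]), dropping the nonnegative
    last distance and bounding each gap [f x^{i+1} - f x_*] below by the gap of
    the best iterate gives the estimate ([best_iterate_bound]).

    Complexity. As soon as the three trial parameters dominate [L], [delta] and
    [Delta], the upper model bound implies the acceptance test
    ([large_params_acceptable]). So when a trial is rejected, one of the three
    parameters is below its target. Each of them has been halved once per
    iteration begun (the one for [L] perhaps lowered less) and doubled once per
    rejection, so the number of rejections exceeds the number of iterations
    begun by at most the base-two logarithm of twice the target over the initial
    value. Adding one accepted problem per iteration gives the bound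
    ([execution_count]). *)

(** * Convex and differentiable functions on R^n *)

Lemma dotp_gradE (R : realType) (n : nat) (d : 'rV[R]_n -> R) x v :
  differentiable d x -> dotp (grad d x) v = 'd d x v.
Proof.
move=> dx; rewrite {2}(row_sum_delta v) linear_sum /dotp.
by apply: eq_bigr => i _; rewrite mxE deriveE // linearZ mulrC.
Qed.

(** Divide by [t] and let [t] tend to zero from the right. *)
Lemma diff_ge_of_secant (R : realType) (n : nat) (d : 'rV[R]_n -> R) x v c :
  differentiable d x ->
  (forall t, 0 < t -> t <= 1 -> t * c <= d (t *: v + x) - d x) ->
  c <= 'd d x v.
Proof.
move=> dx hc; rewrite -deriveE //.
have /cvg_dnbhs_at_right h := @diff_derivable _ _ _ _ _ v dx.
apply: (cvgr_to_ge h).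
near=> t.
have t0 : 0 < t by near: t; exact: nbhs_right_gt.
rewrite /= -[leLHS](mulKf (lt0r_neq0 t0)) ler_pM2l ?invr_gt0 //.
apply: hc => //.
by near: t; apply: nbhs_right_ltW.
Unshelve. all: by end_near.
Qed.

Lemma diff_le_of_secant (R : realType) (n : nat) (d : 'rV[R]_n -> R) x v c :
  differentiable d x ->
  (forall t, 0 < t -> t <= 1 -> d (t *: v + x) - d x <= t * c) ->
  'd d x v <= c.
Proof.
move=> dx hc.
have := @diff_ge_of_secant R n (- d) x v (- c) (differentiableN dx).
rewrite diffN // lerN2; apply=> t t0 t1.
by rewrite mulrN /= -opprD lerN2; apply: hc.
Qed.

(** The left-hand side has the shape of the increments in
    [diff_ge_of_secant] and [diff_le_of_secant]. *)
Lemma convex_function_secant (R : realType) (n : nat) (Q : set 'rV[R]_n)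
    (g : 'rV[R]_n -> R) x y t :
  convex_function Q g -> Q x -> Q y -> 0 < t -> t <= 1 ->
  g (t *: (y - x) + x) - g x <= t * (g y - g x).
Proof.
move=> cg /mem_set Qx /mem_set Qy t0 t1.
have -> : t *: (y - x) + x = t *: y + (1 - t) *: x.
  by rewrite scalerBr scalerBl scale1r addrAC addrA.
have : g (t *: y + (1 - t) *: x) <= t * g y + (1 - t) * g x
  := cg (Itv01 (ltW t0) t1) y x Qy Qx.
lra.
Qed.

Lemma convex_set_segment (R : realType) (n : nat) (Q : set 'rV[R]_n) x y t :
  convex_set Q -> Q x -> Q y -> 0 < t -> t <= 1 -> Q (t *: (y - x) + x).
Proof.
move=> cQ /mem_set Qx /mem_set Qy t0 t1.
have -> : t *: (y - x) + x = t *: y + (1 - t) *: x.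
  by rewrite scalerBr scalerBl scale1r addrAC addrA.
have := cQ y x (Itv01 (ltW t0) t1) Qy Qx.
exact: set_mem.
Qed.

Lemma norm_ge0 (R : realType) (n : nat) (N : 'rV[R]_n -> R) x :
  is_norm N -> 0 <= N x.
Proof.
case=> tri hom _; have := tri x (-1 *: x).
rewrite scaleN1r subrr -(scale0r x) hom -scaleN1r hom normr0 normrN1; lra.
Qed.

(** The graph of [d] lies above its tangent at [x]. *)
Lemma bregman_ge0 (R : realType) (n : nat) (Q : set 'rV[R]_n)
    (d : 'rV[R]_n -> R) x y :
  convex_function Q d -> Q x -> Q y -> differentiable d x ->
  0 <= bregman d y x.
Proof.
move=> cd Qx Qy dx; rewrite /bregman dotp_gradE // subr_ge0.
apply: diff_le_of_secant => // t t0 t1.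
exact: convex_function_secant cd Qx Qy t0 t1.
Qed.

(** First-order optimality of [z] along the segment to [u] says
      [g z - g u <= l * ('d d z (u - z) - dotp (grad d x) (u - z))],
    and the bracket equals [V u x - V u z - V z x]. Only [d] is differentiated:
    the increment of [g] is bounded by its secant. *)
Lemma prox_three_point (R : realType) (n : nat) (Q : set 'rV[R]_n)
    (d g : 'rV[R]_n -> R) (l : R) x z u :
  convex_set Q -> convex_function Q g -> differentiable d z -> 0 < l ->
  is_argmin Q (fun y => g y + l * bregman d y x) z -> Q u ->
  g z + l * bregman d z x + l * bregman d u z <= g u + l * bregman d u x.
Proof.
move=> cQ cg dz l0 [Qz hz] Qu.
have dotpD a b : dotp (grad d x) (a + b) = dotp (grad d x) a + dotp (grad d x) b.
  by rewrite /dotp -big_split /=; apply: eq_bigr => i _; rewrite [(a + b) _ _]mxE mulrDr.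
have dotpZ t a : dotp (grad d x) (t *: a) = t * dotp (grad d x) a.
  by rewrite /dotp mulr_sumr; apply: eq_bigr => i _; rewrite [(t *: a) _ _]mxE mulrCA.
have : dotp (grad d x) (u - z) - (g u - g z) / l <= 'd d z (u - z).
  apply: diff_ge_of_secant => // t t0 t1.
  have gt := convex_function_secant cg Qz Qu t0 t1.
  have := hz _ (convex_set_segment cQ Qz Qu t0 t1).
  rewrite /bregman -[t *: _ + _ - _]addrA (dotpD (t *: _)) dotpZ => opt.
  rewrite -(ler_pM2l l0) !mulrBr mulrCA [l * (t * (_ / _))]mulrCA.
  rewrite [l * (_ / _)]mulrC mulfVK ?lt0r_neq0 //; lra.
rewrite -(ler_pM2l l0) mulrBr [l * (_ / _)]mulrC mulfVK ?lt0r_neq0 // => first_order.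
have : dotp (grad d x) (u - x) = dotp (grad d x) (u - z) + dotp (grad d x) (z - x).
  by rewrite -dotpD addrA subrK.
rewrite /bregman (dotp_gradE _ dz) => ->; lra.
Qed.

(** * Auxiliary estimates on real numbers *)

Lemma linear_recursion_le (R : realType) (q b D : nat -> R) k :
  (forall i, (i < k)%N -> 0 <= q i /\ D i.+1 <= q i * D i + b i) ->
  D k <= \prod_(0 <= i < k) q i * D 0%N
         + \sum_(0 <= i < k) b i * \prod_(i.+1 <= j < k) q j.
Proof.
elim: k => [_|k IH h]; first by rewrite !big_geq // mul1r addr0.
have [qk Dk] := h k (ltnSn k).
have sumE : \sum_(0 <= i < k.+1) b i * \prod_(i.+1 <= j < k.+1) q j
        = (\sum_(0 <= i < k) b i * \prod_(i.+1 <= j < k) q j) * q k + b k.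
  rewrite (big_nat_recr k 0) //= (big_geq (leqnn k.+1)) mulr1; congr (_ + _).
  rewrite mulr_suml !big_nat; apply: eq_bigr => i /andP[_ ik].
  by rewrite (big_nat_recr k i.+1) //= mulrA.
have {h}IH := IH (fun i ik => h i (ltnW ik)).
have := ler_wpM2l qk IH.
rewrite sumE (big_nat_recr k 0) //=; lra.
Qed.

Lemma pow2_scale_le_log2 (R : realType) (a b : R) r m :
  0 < a -> 0 < b -> 2 ^+ r * a <= 2 ^+ m * b -> r%:R <= m%:R + log2 (b / a).
Proof.
move=> a0 b0 h.
have l2 : 0 < ln (2 : R) by apply: ln_gt0; lra.
have p2 k : (0 : R) < 2 ^+ k by apply: exprn_gt0; lra.
have : ln (2 ^+ r * a) <= ln (2 ^+ m * b).
  by rewrite ler_ln // posrE mulr_gt0.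
rewrite !lnM ?posrE // !lnXn; try lra.
rewrite -(mulr_natl (ln 2) r) -(mulr_natl (ln 2) m) => hl.
rewrite /log2 -(ler_pM2r l2) mulrDl mulfVK ?lt0r_neq0 // ln_div ?posrE //; lra.
Qed.

(** * Runs of the method *)

Lemma start_params_bounds (R : realType) (mu : R) p :
  0 < pL p -> 0 < pL (start_params mu p) /\ mu <= pL (start_params mu p).
Proof. by move=> h; rewrite /= le_max lexx lt_max divr_gt0 ?orbT. Qed.

(** The maximum with [mu] can only raise the halved parameter, so one doubling
    always undoes the start of an iteration. *)
Lemma start_params_halve (R : realType) (mu : R) p :
  pL p <= 2 * pL (start_params mu p).
Proof. by rewrite -ler_pdivrMl // [2^-1 * _]mulrC le_max lexx orbT. Qed.

(** An entry [j] appended to the log counts only for the bounds [B k] with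
    [j < k]; for these, comparing the total length with [B k] is enough. *)
Lemma count_rcons_le (R : realType) (B : nat -> R) (s : seq nat) j :
  (forall k, (count (fun i => i < k)%N s)%:R <= B k) ->
  (forall k, (j < k)%N -> (size s).+1%:R <= B k) ->
  forall k, (count (fun i => i < k)%N (rcons s j))%:R <= B k.
Proof.
move=> hs hj k; rewrite -cats1 count_cat /= addn0.
case: ltnP => [jk|_]; last by rewrite addn0.
apply: le_trans (hj k jk); rewrite addn1 ler_nat ltnS.
exact: count_size.
Qed.

Section Run.
Context {R : realType} {n : nat}.
Context {N : 'rV[R]_n -> R} (hN : is_norm N).
Context {Q : set 'rV[R]_n} (Qconvex : convex_set Q).
Context {d : 'rV[R]_n -> R} (dconvex : convex_function Q d).
Context (ddiff : forall x, Q x -> differentiable d x).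
Context {f fdelta : 'rV[R]_n -> R} {psi : 'rV[R]_n -> 'rV[R]_n -> R}.
Context {delta Delta L mu : R}.
Context (hfdelta : inexact_value Q f fdelta delta).
Context (hmodel : has_model Q f fdelta psi (bregman d) N delta Delta L mu).

Local Notation V := (bregman d).
Local Notation nearest := (nearest_minimizer Q f V).

(** What the analysis of one iteration needs to know about an iterate, the
    parameters accepted there and the next iterate. *)
Definition accepted_step x (p : params R) z : Prop :=
  [/\ Q x, 0 < pL p, mu <= pL p,
      is_argmin Q (fun y => psi y x + pL p * V y x) z &
      acceptable fdelta psi V N x p z].

(** The three-point inequality at the minimizer nearest to [x], the acceptance
    test and the lower model bound add up to this inequality with [V xs z] on
    the left, and [V zs z] is not larger because [zs] is nearest to [z]. *)
Lemma accepted_step_descent x p z xs zs :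
  accepted_step x p z -> nearest xs x -> nearest zs z ->
  V zs z <= (1 - mu / pL p) * V xs x
    + (delta + pdelta p + pDelta p * N (z - x) - (f z - f xs)) / pL p.
Proof.
move=> [Qx p0 _ zmin zacc] [[Qxs xsmin] xsnear] [[Qzs zsmin] zsnear].
have Qz := proj1 zmin.
(* The model bound holds at some nearest minimizer [ys], possibly not [xs];
   both have the same value of [f] and the same divergence from [x]. *)
have [ys [[Qys ysmin] ysnear] [_ lower]] := model_lower hmodel Qx.
have fE : f ys = f xs by apply/eqP; rewrite eq_le ysmin // xsmin.
have VE : V ys x = V xs x.
  by apply/eqP; rewrite eq_le (ysnear xs) // (xsnear ys).
have Vzs : V zs z <= V ys z by apply: zsnear; split.
have key := prox_three_point Qconvex (model_convex hmodel Qx)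
  (ddiff Qz) p0 zmin Qys.
have [fz _] := hfdelta Qz.
move: zacc; rewrite /acceptable => zacc.
rewrite fE VE in lower; rewrite VE in key.
rewrite -(ler_pM2l p0) in Vzs.
have -> : (1 - mu / pL p) * V xs x
    + (delta + pdelta p + pDelta p * N (z - x) - (f z - f xs)) / pL p
  = ((pL p - mu) * V xs x
    + (delta + pdelta p + pDelta p * N (z - x) - (f z - f xs))) / pL p.
  by field; rewrite lt0r_neq0.
rewrite ler_pdivlMr // mulrC; lra.
Qed.

(** The acceptance test is the upper model bound with the trial parameters in
    place of [L], [delta], [Delta] and [fdelta z] in place of the larger [f z];
    it is monotone in the parameters because the divergence and the norm are
    nonnegative. *)
Lemma large_params_acceptable x p z :
  Q x -> Q z -> L <= pL p -> delta <= pdelta p -> Delta <= pDelta p ->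
  acceptable fdelta psi V N x p z.
Proof.
move=> Qx Qz hL hd hD; rewrite /acceptable.
have := model_upper hmodel Qx Qz.
have [_ fz] := hfdelta Qz.
have := ler_wpM2r (norm_ge0 (z - x) hN) hD.
have := ler_wpM2r (bregman_ge0 dconvex Qx Qz (ddiff Qx)) hL.
lra.
Qed.

Context {x0 : 'rV[R]_n} (Qx0 : Q x0) {p0 : params R}.
Context (L0_gt0 : 0 < pL p0).

Local Notation run := (execution Q fdelta psi V N mu x0 p0).

(** Since the default value of [nth] is [x0], the third clause needs no bound
    on [i]. *)
Lemma execution_invariant xs ps p s : run xs ps p s ->
  [/\ size ps = size xs, (0 < size xs)%N /\ nth x0 xs 0 = x0,
      forall i, Q (nth x0 xs i),
      0 < pL p /\ mu <= pL p &
      forall i, (i.+1 < size xs)%N ->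
        accepted_step (nth x0 xs i) (nth p0 ps i.+1) (nth x0 xs i.+1)].
Proof.
elim=> {xs ps p s}.
- split=> //; last exact: start_params_bounds.
  by move=> [|i] //=; rewrite nth_nil.
- move=> xs ps p s z _ [sz [xs0 hd] hQ [pL0 pmu] hstep] zmin zacc; split.
  + by rewrite !size_rcons sz.
  + by rewrite size_rcons nth_rcons xs0.
  + move=> i; rewrite nth_rcons; case: ifP => // _.
    by case: ifP => // _; exact: proj1 zmin.
  + exact: start_params_bounds.
  + move=> i; rewrite size_rcons ltnS => ilt.
    rewrite !nth_rcons sz ilt.
    move: (ilt); rewrite leq_eqVlt => /orP[/eqP iE|ilt2].
      rewrite iE ltnn eqxx; split=> //.
        by rewrite -[nth _ _ _]/(nth x0 xs i.+1.-1) iE nth_last.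
      by rewrite -[nth _ _ _]/(nth x0 xs i.+1.-1) iE nth_last.
    by rewrite ilt2; exact: hstep.
- move=> xs ps p s z _ [sz [xs0 hd] hQ [pL0 pmu] hstep] _ _; split=> //=.
  split; lra.
Qed.


Context (delta0_gt0 : 0 < pdelta p0) (Delta0_gt0 : 0 < pDelta p0).
Context (L0_le : pL p0 <= 2 * L) (delta0_le : pdelta p0 <= 2 * delta)
  (Delta0_le : pDelta p0 <= 2 * Delta).

(** The real number of doublings after which each initial parameter has reached
    twice its target. *)
Definition log_excess : R :=
  Num.max (log2 (2 * L / pL p0))
    (Num.max (log2 (2 * delta / pdelta p0)) (log2 (2 * Delta / pDelta p0))).

(** * Number of auxiliary problems *)

(** Here [r] is the number of rejections so far, and [size xs] the number of
    iterations begun. The powers of two record the doublings and halvings; for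
    [L] there is only an inequality because of the maximum with [mu]. The
    index of the current iteration is [(size xs).-1], which is also the number
    of accepted problems. *)
Lemma execution_count xs ps p s : run xs ps p s ->
  (exists r : nat,
    [/\ size s = ((size xs).-1 + r)%N, r%:R <= (size xs)%:R + log_excess,
      2 ^+ r * pL p0 <= 2 ^+ size xs * pL p,
      2 ^+ r * pdelta p0 = 2 ^+ size xs * pdelta p &
      2 ^+ r * pDelta p0 = 2 ^+ size xs * pDelta p]) /\
  forall k, (count (fun i => i < k)%N s)%:R <= 2 * k%:R + log_excess.
Proof.
have M_ge0 : 0 <= log_excess.
  rewrite /log_excess le_max; apply/orP; left.
  have := @pow2_scale_le_log2 R (pL p0) (2 * L) 0 0 L0_gt0.
  rewrite !expr0 !mul1r add0r; apply=> //; exact: lt_le_trans L0_gt0 L0_le.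
elim=> {xs ps p s}.
- split; last by move=> k /=; rewrite addr_ge0 // mulr_ge0.
  exists 0%N => /=; rewrite !expr0 !mul1r expr1; split=> //.
  + by rewrite addr_ge0.
  + exact: start_params_halve.
  + by field.
  + by field.
- move=> xs ps p s z hrun [[r [sizes rle rL rdelta rDelta]] hcount] _ _.
  have [_ [xs0 _] _ _ _] := execution_invariant hrun.
  have e2 : 2 ^+ (size xs).+1 = 2 * 2 ^+ size xs :> R by rewrite exprS.
  have natS : (size xs).+1%:R = (size xs)%:R + 1 :> R by rewrite -natr1.
  split.
    exists r; rewrite !size_rcons sizes e2 natS /=; split.
    + by rewrite -addSn prednK.
    + lra.
    + apply: (le_trans rL); rewrite mulrAC mulrC ler_pM2r ?exprn_gt0 //.
      exact: start_params_halve.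
    + by rewrite rdelta; field.
    + by rewrite rDelta; field.
  apply: count_rcons_le => // k.
  rewrite prednK // sizes -addSn prednK // natrD => ltk.
  have : (size xs)%:R <= k%:R :> R by rewrite ler_nat.
  lra.
- move=> xs ps p s z hrun [[r [sizes rle rL rdelta rDelta]] hcount] [Qz _] nacc.
  have [_ [xs0 _] hQ [pL0 _] _] := execution_invariant hrun.
  (* Whichever parameter is below its target limits the doublings made. *)
  have rSle : r.+1%:R <= (size xs)%:R + log_excess.
    have eqW (a b : R) : a = b -> a <= b by move=> ->.
    have bound (a a0 b : R) : 0 < a0 -> a0 <= 2 * b ->
        2 ^+ r * a0 <= 2 ^+ size xs * a -> a <= b ->
        r.+1%:R <= (size xs)%:R + log2 (2 * b / a0).
      move=> h0 hb ha ab; apply: pow2_scale_le_log2 => //; first lra.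
      have := ler_wpM2l (exprn_ge0 (size xs) (ler0n R 2)) ab.
      rewrite exprS; lra.
    have [hL|hL] := lerP L (pL p); last first.
      apply: le_trans (bound _ _ _ L0_gt0 L0_le rL (ltW hL)) _.
      by rewrite lerD2l le_max lexx.
    have [hd|hd] := lerP delta (pdelta p); last first.
      have := bound _ _ _ delta0_gt0 delta0_le (eqW _ _ rdelta) (ltW hd).
      move/le_trans; apply.
      by rewrite lerD2l !le_max lexx orbT.
    have [hD|hD] := lerP Delta (pDelta p); last first.
      have := bound _ _ _ Delta0_gt0 Delta0_le (eqW _ _ rDelta) (ltW hD).
      move/le_trans; apply.
      by rewrite lerD2l !le_max lexx !orbT.
    case: nacc; apply: large_params_acceptable => //.
    by rewrite -nth_last.
  split.
    exists r.+1; rewrite size_rcons sizes addnS; split=> //=; rewrite exprS.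
    + by rewrite -mulrA [leRHS]mulrCA ler_pM2l.
    + by rewrite -mulrA rdelta mulrCA.
    + by rewrite -mulrA rDelta mulrCA.
  apply: count_rcons_le => // k.
  rewrite prednK // sizes -addnS natrD => ltk.
  have : (size xs)%:R <= k%:R :> R by rewrite ler_nat.
  have : ((size xs).-1)%:R <= (size xs)%:R :> R by rewrite ler_nat leq_pred.
  lra.
Qed.

(** * Convergence *)

Context (xstar : 'rV[R]_n) (hxstar : nearest xstar x0).

(** The sequence to which the recursion applies is the divergence of [x_ i]
    from a minimizer nearest to [x_ i], chosen for each [i]. *)
Lemma best_iterate_bound xs ps p s k y :
  let x_ i := nth x0 xs i in
  let p_ i := nth p0 ps i in
  let W i := (pL (p_ i.+1))^-1
             * \prod_(i.+1 <= j < k.+1) (1 - mu / pL (p_ j.+1)) in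
  run xs ps p s -> (k.+1 < size xs)%N ->
  (forall i, (i <= k)%N -> f y <= f (x_ i.+1)) ->
  f y - f xstar <=
    (\sum_(0 <= i < k.+1) W i)^-1 *
    (\prod_(0 <= i < k.+1) (1 - mu / pL (p_ i.+1)) * V xstar x0 +
     \sum_(0 <= i < k.+1)
       (delta + pdelta (p_ i.+1) + pDelta (p_ i.+1) * N (x_ i.+1 - x_ i))
       * W i).
Proof.
move=> x_ p_ W hrun ltk ymin.
have [_ [_ x_0] hQ _ hstep] := execution_invariant hrun.
pose q i := 1 - mu / pL (p_ i.+1).
pose e i := delta + pdelta (p_ i.+1) + pDelta (p_ i.+1) * N (x_ i.+1 - x_ i).
have {}hstep i : (i < k.+1)%N -> accepted_step (x_ i) (p_ i.+1) (x_ i.+1).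
  by move=> ik; apply: hstep; apply: leq_trans ltk.
have q_ge0 i : (i < k.+1)%N -> 0 <= q i.
  by move=> /hstep[_ l0 lmu _ _]; rewrite subr_ge0 ler_pdivrMr // mul1r.
have W_ge0 i : (i < k.+1)%N -> 0 <= W i.
  move=> ik; have [_ l0 _ _ _] := hstep _ ik.
  rewrite mulr_ge0 ?invr_ge0 ?(ltW l0) // big_nat prodr_ge0 // => j /andP[_].
  exact: q_ge0.
(* The last weight is the reciprocal of a parameter: its product is empty. *)
have Wk : 0 < W k.
  have [_ l0 _ _ _] := hstep _ (ltnSn k).
  by rewrite /W big_geq // mulr1 invr_gt0.
have W_sum_gt0 : 0 < \sum_(0 <= i < k.+1) W i.
  rewrite big_nat_recr //= ltr_wpDl // big_nat sumr_ge0 // => i /andP[_ ik].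
  by apply: W_ge0; apply: ltnW.
have [xs_ hxs_] : {xs_ : nat -> 'rV[R]_n & forall i, nearest (xs_ i) (x_ i)}.
  apply: (@choice _ _ (fun i z => nearest z (x_ i))) => i.
  by have [ys ? _] := model_lower hmodel (hQ i); exists ys.
have fE i : f (xs_ i) = f xstar.
  have [[Q1 m1] _] := hxs_ i; have [[Q2 m2] _] := hxstar.
  by apply/eqP; rewrite eq_le m1 // m2.
have V0 : V (xs_ 0%N) (x_ 0%N) = V xstar x0.
  have := hxs_ 0%N; rewrite /x_ x_0 => -[m1 n1]; have [m2 n2] := hxstar.
  by apply/eqP; rewrite eq_le n1 // n2.
have := @linear_recursion_le R q
  (fun i => (e i - (f (x_ i.+1) - f xstar)) / pL (p_ i.+1))
  (fun i => V (xs_ i) (x_ i)) k.+1.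
rewrite V0 => /(_ _)/wrap[i ik|].
  split; first exact: q_ge0.
  by have := accepted_step_descent (hstep _ ik) (hxs_ i) (hxs_ i.+1); rewrite fE.
have VK : 0 <= V (xs_ k.+1) (x_ k.+1).
  have [[Q1 _] _] := hxs_ k.+1.
  exact: bregman_ge0 dconvex (hQ _) Q1 (ddiff (hQ _)).
have -> : \sum_(0 <= i < k.+1) (e i - (f (x_ i.+1) - f xstar)) / pL (p_ i.+1)
            * \prod_(i.+1 <= j < k.+1) q j
   = \sum_(0 <= i < k.+1) e i * W i
     - \sum_(0 <= i < k.+1) (f (x_ i.+1) - f xstar) * W i.
  rewrite -sumrB; apply: eq_bigr => i _.
  by rewrite -mulrBl mulrA.
have gap : (f y - f xstar) * \sum_(0 <= i < k.+1) W i
    <= \sum_(0 <= i < k.+1) (f (x_ i.+1) - f xstar) * W i.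
  rewrite mulr_sumr !big_nat; apply: ler_sum => i /andP[_ ik].
  by rewrite ler_wpM2r ?W_ge0 // lerD2r ymin.
rewrite ler_pdivlMl // mulrC; lra.
Qed.

End Run.

Theorem mainTheorem1 (R : realType) (n : nat)
  (N : 'rV[R]_n -> R) (hN : is_norm N)
  (Q : set 'rV[R]_n) (Qclosed : closed Q) (Qconvex : convex_set Q)
  (d : 'rV[R]_n -> R) (dconvex : convex_function Q d)
  (ddiff : forall x, Q x -> differentiable d x)
  (f fdelta : 'rV[R]_n -> R) (psi : 'rV[R]_n -> 'rV[R]_n -> R)
  (delta Delta L mu : R)
  (delta_ge0 : 0 <= delta)
  (hfdelta : inexact_value Q f fdelta delta)
  (hmodel : has_model Q f fdelta psi (bregman d) N delta Delta L mu)
  (x0 : 'rV[R]_n) (Qx0 : Q x0)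
  (xstar : 'rV[R]_n) (hxstar : nearest_minimizer Q f (bregman d) xstar x0)
  (Rad : R) (hRad : bregman d xstar x0 <= Rad ^+ 2)
  (L0 delta0 Delta0 : R)
  (L0_gt0 : 0 < L0) (delta0_gt0 : 0 < delta0) (Delta0_gt0 : 0 < Delta0)
  (mu_lt_L0 : 2 * mu < L0) (L0_le : L0 <= 2 * L)
  (delta0_le : delta0 <= 2 * delta) (Delta0_le : Delta0 <= 2 * Delta)
  (xs : seq 'rV[R]_n) (ps : seq (params R)) (p : params R) (s : seq nat)
  (hexec : execution Q fdelta psi (bregman d) N mu x0 (Params L0 delta0 Delta0)
             xs ps p s) :
  let x_ i := nth x0 xs i in
  let p_ i := nth (Params L0 delta0 Delta0) ps i in
  let L_ i := pL (p_ i) in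
  let delta_ i := pdelta (p_ i) in
  let Delta_ i := pDelta (p_ i) in
  (* L_ j.+1 is the parameter accepted in iteration j; with L_ j in its place
     the bound is false already for k = 1. *)
  let W_ k i := (L_ i.+1)^-1 * \prod_(i.+1 <= j < k.+1) (1 - mu / L_ j.+1) in
  (forall k : nat, (k.+1 < size xs)%N ->
     forall y : 'rV[R]_n,
       (exists2 i : nat, (i <= k)%N & y = x_ i.+1) ->
       (forall i : nat, (i <= k)%N -> f y <= f (x_ i.+1)) ->
       f y - f xstar <=
         (\sum_(0 <= i < k.+1) W_ k i)^-1 *
         (\prod_(0 <= i < k.+1) (1 - mu / L_ i.+1) * bregman d xstar x0 +
          \sum_(0 <= i < k.+1)
             (delta + delta_ i.+1 + Delta_ i.+1 * N (x_ i.+1 - x_ i)) * W_ k i))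
  /\
  (forall k : nat,
     (count (fun i => i < k)%N s)%:R <=
       2 * k%:R + Num.max (log2 (2 * L / L0))
                    (Num.max (log2 (2 * delta / delta0))
                             (log2 (2 * Delta / Delta0)))).
Proof.
move=> x_ p_ L_ delta_ Delta_ W; split.
  move=> k ltk y _ ymin.
  exact: (best_iterate_bound Qconvex dconvex ddiff hfdelta hmodel Qx0
    (p0 := Params L0 delta0 Delta0) L0_gt0 hxstar hexec ltk ymin).
exact: (proj2 (execution_count hN dconvex ddiff hfdelta hmodel Qx0
  (p0 := Params L0 delta0 Delta0) L0_gt0 delta0_gt0 Delta0_gt0 L0_le
  delta0_le Delta0_le hexec)).
Qed.
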